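(* Let $\mathbf A$ be a Nelson-type algebra, let $\mathbf n(x)=(x\wedge e)^2$ for $x\in A$, let $\mathbf H_{\mathbf A}=(\mathbf n[A],\vee,\wedge_{\mathbf n},\to_{\mathbf n},e)$, let $\imath=\mathbf n(\sim e)$, and let $F_A=\{\mathbf n(x\vee\sim x):x\in A\}$. Then $$\mathbf A\cong\mathbf{Tw}(\mathbf H_{\mathbf A},\imath,F_A).$$
   Context: A commutative residuated lattice is an algebra $(A,\wedge,\vee,\cdot,\to,e)$ such that $(A,\wedge,\vee)$ is a lattice, $(A,\cdot,e)$ is a commutative monoid, and $xy\le z$ iff $y\le x\to z$. A commutative involutive residuated lattice has in addition a unary operation $\sim$ satisfying $\sim\sim x=x$ and $x\to\sim y=y\to\sim x$. A Nelson-type algebra is a commutative involutive residuated lattice with distributive lattice reduct satisfying $xy=(x\wedge e)^2y\vee x(y\wedge e)^2$ and $(xy\wedge e)^2=(x\wedge e)^2(y\wedge e)^2$. For a Nelson-type algebra $\mathbf A$ and $\mathbf n(x)=(x\wedge e)^2$, put $x\wedge_{\mathbf n}y=\mathbf n(x\wedge y)$ and $x\to_{\mathbf n}y=\mathbf n(x\to y)$ for $x,y\in\mathbf n[A]$. Then $\mathbf H_{\mathbf A}=(\mathbf n[A],\vee,\wedge_{\mathbf n},\to_{\mathbf n},e)$ is a Brouwerian algebra, i.e. an algebra $(H,\vee,\wedge,\to,1)$ where $(H,\vee,\wedge)$ is a lattice with top $1$ and $x\wedge y\le z$ iff $y\le x\to z$ (here $\cdot$ coincides with $\wedge_{\mathbf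 n}$ and $1=e$). A Boolean filter of a Brouwerian algebra $\mathbf H$ is a lattice filter $F$ with $x\vee(x\to y)\in F$ for all $x,y\in H$. ($F_A$ is a Boolean filter of $\mathbf H_{\mathbf A}$.) For a Brouwerian algebra $\mathbf H$, $\imath\in H$ and a Boolean filter $F$, $\mathbf{Tw}(\mathbf H,\imath,F)$ is the commutative involutive residuated lattice with universe $\{(a,b)\in H\times H: a\wedge b\le\imath,\ a\vee b\in F\}$, operations $(a,b)\wedge(a',b')=(a\wedge a',b\vee b')$, $(a,b)\vee(a',b')=(a\vee a',b\wedge b')$, $\sim(a,b)=(b,a)$, $(a,b)\cdot(a',b')=(a\wedge a',(a\to b')\wedge(a'\to b))$, $(a,b)\to(a',b')=((a\to a')\wedge(b'\to b),a\wedge b')$, and identity $(1,\imath)$. *)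

(* Defs.v *)
From HB Require Import structures.
From mathcomp Require Import all_boot all_order.
From mathcomp Require Import boolp classical_sets.

Set Implicit Arguments.
Unset Strict Implicit.
Unset Printing Implicit Defensive.

Import Order.TTheory.

Local Open Scope group_scope.
Local Open Scope order_scope.

Declare Scope residuated_scope.
Delimit Scope residuated_scope with res.
Reserved Notation "x ~> y" (at level 55, right associativity).
Reserved Notation "x =>> y" (at level 55, right associativity).
Reserved Notation "\~ x" (at level 35, right associativity).

HB.mixin Record isCommResiduated (d : Order.disp_t) A
    of Order.Lattice d A & monoid.Monoid A := {
  resid : A -> A -> A;
  mulgC : commutative (@monoid.mul A);
  residP : forall x y z : A, (x * y <= z) = (y <= resid x z)
}.

#[short(type="crlType")]
HB.structure Definition CRL (d : Order.disp_t) :=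
  { A of Order.Lattice d A & monoid.Monoid A & isCommResiduated d A }.

Notation "x ~> y" := (resid x y) : residuated_scope.
Local Open Scope residuated_scope.

HB.mixin Record isInvolutiveCRL (d : Order.disp_t) A of CRL d A := {
  neg : A -> A;
  negK : forall x : A, neg (neg x) = x;
  resid_neg : forall x y : A, x ~> neg y = y ~> neg x
}.

#[short(type="cirlType")]
HB.structure Definition CIRL (d : Order.disp_t) :=
  { A of CRL d A & isInvolutiveCRL d A }.

Notation "\~ x" := (neg x) : residuated_scope.

HB.mixin Record isNelsonType (d : Order.disp_t) A
    of Order.DistrLattice d A & CIRL d A := {
  nelson_mulE : forall x y : A,
    x * y = ((x `&` 1) ^+ 2 * y) `|` (x * (y `&` 1) ^+ 2);
  nelson_sqrM : forall x y : A,
    (x * y `&` 1) ^+ 2 = (x `&` 1) ^+ 2 * (y `&` 1) ^+ 2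
}.

#[short(type="nelsonType")]
HB.structure Definition NelsonType (d : Order.disp_t) :=
  { A of Order.DistrLattice d A & CIRL d A & isNelsonType d A }.

HB.mixin Record isBrouwerian (d : Order.disp_t) H of Order.TLattice d H := {
  bimp : H -> H -> H;
  bimpP : forall x y z : H, (x `&` y <= z) = (y <= bimp x z)
}.

#[short(type="brouwerianType")]
HB.structure Definition Brouwerian (d : Order.disp_t) :=
  { H of Order.TLattice d H & isBrouwerian d H }.

Notation "x =>> y" := (bimp x y) : residuated_scope.

Definition cirl_isomorphism (d d' : Order.disp_t) (A : cirlType d)
    (B : cirlType d') (f : A -> B) : Prop :=
  bijective f /\
  [/\ {morph f : x y / x `&` y}, {morph f : x y / x `|` y},
      {morph f : x y / x * y}, {morph f : x y / x ~> y}
    & {morph f : x / \~ x} /\ f 1 = 1].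

Definition cirl_isomorphic (d d' : Order.disp_t) (A : cirlType d)
    (B : cirlType d') : Prop := exists f : A -> B, cirl_isomorphism f.

Section BooleanFilter.
Context {d : Order.disp_t} (H : brouwerianType d).

Definition boolean_filter (F : set H) : Prop :=
  [/\ exists x, F x,
      forall x y, F x -> x <= y -> F y,
      forall x y, F x -> F y -> F (x `&` y)
    & forall x y, F (x `|` (x =>> y))].

Record booleanFilter :=
  BooleanFilter { bf_set :> set H; bf_boolean : boolean_filter bf_set }.

End BooleanFilter.

Section BrouwerianTheory.
Context {d : Order.disp_t} {H : brouwerianType d}.
Implicit Types x y z : H.

Lemma bimpPr x y z : (x `&` y <= z) = (x <= (y =>> z)).
Proof. by rewrite meetC bimpP. Qed.

Lemma bimp_mp x y : x `&` (x =>> y) <= y.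
Proof. by rewrite bimpP. Qed.

Lemma bmeetUr x y z : x `&` (y `|` z) = (x `&` y) `|` (x `&` z).
Proof.
apply: le_anti; rewrite bimpP leUx -!bimpP leUl leUr /=.
by rewrite leUx !lexI !leIl /= !(le_trans (leIr _ _)) ?leUl ?leUr.
Qed.

Lemma bmeetUl x y z : (y `|` z) `&` x = (y `&` x) `|` (z `&` x).
Proof. by rewrite !(meetC _ x) bmeetUr. Qed.

Lemma bjoinIr x y z : x `|` (y `&` z) = (x `|` y) `&` (x `|` z).
Proof.
rewrite bmeetUr (meetC (x `|` y) x) joinKI (meetC (x `|` y)) bmeetUr joinA.
by rewrite (meetC z x) meetKU (meetC z).
Qed.

Lemma bjoinIl x y z : (y `&` z) `|` x = (y `|` x) `&` (z `|` x).
Proof. by rewrite !(joinC _ x) bjoinIr. Qed.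

Lemma bimp_le2 x y z : y <= z -> (x =>> y) <= (x =>> z).
Proof. by move=> h; rewrite -bimpP (le_trans (bimp_mp _ _)). Qed.

Lemma bimpI x y z : x =>> (y `&` z) = (x =>> y) `&` (x =>> z).
Proof.
apply: le_anti; rewrite lexI !bimp_le2 ?leIl ?leIr //= -bimpP lexI.
by apply/andP; split; rewrite bimpP ?leIl ?leIr.
Qed.

Lemma bimpM x y z : (x `&` y) =>> z = x =>> (y =>> z).
Proof.
apply/le_anti/andP; split; rewrite -!bimpP.
  by rewrite meetA (meetC y) bimp_mp.
by rewrite (meetC x) -meetA bimpP bimp_mp.
Qed.

Lemma bimp1 x : \top =>> x = x.
Proof. by apply: le_anti; rewrite -bimpP meet1x lexx -{1}(meet1x (_ =>> _)) bimp_mp. Qed.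

End BrouwerianTheory.

(* A booleanFilter is passed, not a bare set: the carrier is closed under the
   product and the residual only because F contains every x `|` (x =>> y). *)
Definition tw_set {d : Order.disp_t} {H : brouwerianType d} (i : H)
    (F : booleanFilter H) : set (H * H) :=
  [set p | p.1 `&` p.2 <= i /\ bf_set F (p.1 `|` p.2)].

Definition Tw (d : Order.disp_t) (H : brouwerianType d) (i : H)
  (F : booleanFilter H) : Type := set_type (tw_set i F).

Section Twist.
Context {d : Order.disp_t} {H : brouwerianType d} {i : H} {F : booleanFilter H}.
Local Notation T := (Tw i F).
Implicit Types x y z : T.

HB.instance Definition _ := SubChoice.copy T (set_type (tw_set i F)).

Lemma tw_le x : (val x).1 `&` (val x).2 <= i.
Proof. by case: (set_mem (valP x)). Qed.

Lemma tw_mem x : bf_set F ((val x).1 `|` (val x).2).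
Proof. by case: (set_mem (valP x)). Qed.

Definition mkTw (p : H * H) (le_i : p.1 `&` p.2 <= i)
    (in_F : bf_set F (p.1 `|` p.2)) : T :=
  exist (fun q => q \in tw_set i F) p
    (@mem_set _ (tw_set i F) p (conj le_i in_F)).

Let Fup (a b : H) : a <= b -> bf_set F a -> bf_set F b.
Proof. by case: (bf_boolean F) => _ up _ _ ab Fa; exact: up Fa ab. Qed.

Let FI (a b : H) : bf_set F a -> bf_set F b -> bf_set F (a `&` b).
Proof. by case: (bf_boolean F) => _ _ + _; apply. Qed.

Let FB (a b : H) : bf_set F (a `|` (a =>> b)).
Proof. by case: (bf_boolean F). Qed.

Fact tw_meet_le x y : ((val x).1 `&` (val y).1) `&` ((val x).2 `|` (val y).2) <= i.
Proof.
rewrite bmeetUr leUx; apply/andP; split.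
  by apply: le_trans (tw_le x); rewrite lexI leIr (le_trans (leIl _ _)) ?leIl.
by apply: le_trans (tw_le y); rewrite lexI leIr (le_trans (leIl _ _)) ?leIr.
Qed.

Fact tw_meet_mem x y :
  bf_set F (((val x).1 `&` (val y).1) `|` ((val x).2 `|` (val y).2)).
Proof.
apply: Fup (FI (tw_mem x) (tw_mem y)); rewrite bjoinIl.
by apply: leI2; apply: leU2; rewrite ?leUl ?leUr.
Qed.

Definition tw_meet x y : T :=
  @mkTw ((val x).1 `&` (val y).1, (val x).2 `|` (val y).2)
    (tw_meet_le x y) (tw_meet_mem x y).

Fact tw_neg_le x : (val x).2 `&` (val x).1 <= i.
Proof. by rewrite meetC tw_le. Qed.

Fact tw_neg_mem x : bf_set F ((val x).2 `|` (val x).1).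
Proof. by rewrite joinC; apply: tw_mem. Qed.

Definition tw_neg x : T :=
  @mkTw ((val x).2, (val x).1) (tw_neg_le x) (tw_neg_mem x).

Fact tw_join_le x y : ((val x).1 `|` (val y).1) `&` ((val x).2 `&` (val y).2) <= i.
Proof. by rewrite meetC; exact: (tw_meet_le (tw_neg x) (tw_neg y)). Qed.

Fact tw_join_mem x y :
  bf_set F (((val x).1 `|` (val y).1) `|` ((val x).2 `&` (val y).2)).
Proof. by rewrite joinC; exact: (tw_meet_mem (tw_neg x) (tw_neg y)). Qed.

Definition tw_join x y : T :=
  @mkTw ((val x).1 `|` (val y).1, (val x).2 `&` (val y).2)
    (tw_join_le x y) (tw_join_mem x y).

Fact tw_mul_le x y :
  ((val x).1 `&` (val y).1) `&`
    (((val x).1 =>> (val y).2) `&` ((val y).1 =>> (val x).2)) <= i.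
Proof.
apply: le_trans (tw_le y).
rewrite lexI (le_trans (leIl _ _)) ?leIr //=.
by apply: le_trans (bimp_mp (val x).1 _); apply: leI2; rewrite leIl.
Qed.

Fact tw_mul_mem x y :
  bf_set F (((val x).1 `&` (val y).1) `|`
    (((val x).1 =>> (val y).2) `&` ((val y).1 =>> (val x).2))).
Proof.
rewrite bjoinIr !bjoinIl; apply: (FI); apply: FI => //.
- by apply: Fup (tw_mem y); rewrite leU2 // -bimpP leIr.
- by apply: Fup (tw_mem x); rewrite leU2 // -bimpP leIr.
Qed.

Definition tw_mul x y : T :=
  @mkTw ((val x).1 `&` (val y).1,
         ((val x).1 =>> (val y).2) `&` ((val y).1 =>> (val x).2))
    (tw_mul_le x y) (tw_mul_mem x y).

Fact tw_resid_le x y :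
  (((val x).1 =>> (val y).1) `&` ((val y).2 =>> (val x).2)) `&`
    ((val x).1 `&` (val y).2) <= i.
Proof. by rewrite meetC; exact: (tw_mul_le x (tw_neg y)). Qed.

Fact tw_resid_mem x y :
  bf_set F ((((val x).1 =>> (val y).1) `&` ((val y).2 =>> (val x).2)) `|`
    ((val x).1 `&` (val y).2)).
Proof. by rewrite joinC; exact: (tw_mul_mem x (tw_neg y)). Qed.

Definition tw_resid x y : T :=
  @mkTw (((val x).1 =>> (val y).1) `&` ((val y).2 =>> (val x).2),
         (val x).1 `&` (val y).2)
    (tw_resid_le x y) (tw_resid_mem x y).

Fact tw_one_le : \top `&` i <= i.
Proof. by rewrite meet1x. Qed.

Fact tw_one_mem : bf_set F (\top `|` i).
Proof.
case: (bf_boolean F) => [[a Fa] _ _ _]; apply: Fup Fa.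
by rewrite join1x lex1.
Qed.

Definition tw_one : T := @mkTw (\top, i) tw_one_le tw_one_mem.

Definition tw_ord x y : bool := ((val x).1 <= (val y).1) && ((val y).2 <= (val x).2).

Lemma twP x y : (val x).1 = (val y).1 -> (val x).2 = (val y).2 -> x = y.
Proof.
by move=> e1 e2; apply: val_inj; rewrite [LHS]surjective_pairing e1 e2 -surjective_pairing.
Qed.

Fact tw_ord_refl : reflexive tw_ord.
Proof. by move=> x; rewrite /tw_ord !lexx. Qed.

Fact tw_ord_anti : antisymmetric tw_ord.
Proof.
move=> x y /andP[/andP[a b] /andP[a' b']].
by apply: twP; apply: le_anti; rewrite ?a ?b ?a' ?b'.
Qed.

Fact tw_ord_trans : transitive tw_ord.
Proof.
move=> y x z /andP[a b] /andP[a' b'].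
by rewrite /tw_ord (le_trans a a') (le_trans b' b).
Qed.

HB.instance Definition _ :=
  Order.Le_isPOrder.Build d T tw_ord_refl tw_ord_anti tw_ord_trans.

Fact tw_meetP x y z : (x <= tw_meet y z) = (x <= y) && (x <= z).
Proof. by rewrite /Order.le /= /tw_ord /= lexI leUx andbACA. Qed.

Fact tw_joinP x y z : (tw_join x y <= z) = (x <= z) && (y <= z).
Proof. by rewrite /Order.le /= /tw_ord /= lexI leUx andbACA. Qed.

HB.instance Definition _ :=
  Order.POrder_MeetJoin_isLattice.Build d T tw_meetP tw_joinP.

Fact tw_mulC : commutative tw_mul.
Proof. by move=> x y; apply: twP; rewrite /= meetC. Qed.

Fact tw_mulA : associative tw_mul.
Proof.
move=> x y z; apply: twP => /=; first by rewrite meetA.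
rewrite !bimpI -!bimpM -!meetA (meetC (val z).1 (val y).1).
rewrite (meetC (val z).1 (val x).1); congr (_ `&` _).
Qed.

Fact tw_mul1 : left_id tw_one tw_mul.
Proof.
move=> x; apply: twP => /=; first by rewrite meet1x.
by rewrite bimp1; apply/meet_idPl; rewrite -bimpP tw_le.
Qed.

Fact tw_mulr1 : right_id tw_one tw_mul.
Proof. by move=> x; rewrite tw_mulC tw_mul1. Qed.

HB.instance Definition _ := monoid.isMonoid.Build T tw_mulA tw_mul1 tw_mulr1.

Fact tw_residP x y z : (x * y <= z) = (y <= tw_resid x z).
Proof.
rewrite /Order.le /= /tw_ord /= !lexI bimpP -!bimpP -andbA; congr (_ && _).
by rewrite andbC (meetC (val z).2).
Qed.

HB.instance Definition _ := isCommResiduated.Build d T tw_mulC tw_residP.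

Fact tw_negK x : tw_neg (tw_neg x) = x.
Proof. exact: twP. Qed.

Fact tw_resid_neg x y : x ~> tw_neg y = y ~> tw_neg x.
Proof. by apply: twP; rewrite /= meetC. Qed.

HB.instance Definition _ := isInvolutiveCRL.Build d T tw_negK tw_resid_neg.

Lemma val_twI x y :
  val (x `&` y) = ((val x).1 `&` (val y).1, (val x).2 `|` (val y).2).
Proof. by []. Qed.

Lemma val_twU x y :
  val (x `|` y) = ((val x).1 `|` (val y).1, (val x).2 `&` (val y).2).
Proof. by []. Qed.

Lemma val_twM x y :
  val (x * y) = ((val x).1 `&` (val y).1,
    ((val x).1 =>> (val y).2) `&` ((val y).1 =>> (val x).2)).
Proof. by []. Qed.

Lemma val_tw_resid x y :
  val (x ~> y) = (((val x).1 =>> (val y).1) `&` ((val y).2 =>> (val x).2),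
    (val x).1 `&` (val y).2).
Proof. by []. Qed.

Lemma val_tw_neg x : val (\~ x) = ((val x).2, (val x).1).
Proof. by []. Qed.

Lemma val_tw1 : val (1 : T) = (\top, i).
Proof. by []. Qed.

End Twist.

Section CIRLTheory.
Context {d : Order.disp_t} {A : cirlType d}.
Implicit Types x y z : A.

Lemma resid_mp x y : x * (x ~> y) <= y.
Proof. by rewrite residP. Qed.

Lemma le_mul2l x y z : y <= z -> x * y <= x * z.
Proof. by move=> yz; rewrite residP (le_trans yz) // -residP. Qed.

Lemma le_mul x y z t : x <= y -> z <= t -> x * z <= y * t.
Proof.
by move=> xy zt; rewrite (le_trans (le_mul2l _ zt)) // mulgC (mulgC y) le_mul2l.
Qed.

Lemma crl_mulUr x y z : x * (y `|` z) = (x * y) `|` (x * z).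
Proof.
apply/le_anti/andP; split; last by rewrite leUx !le_mul2l ?leUl ?leUr.
by rewrite residP leUx -!residP leUl leUr.
Qed.

Lemma crl_mulUl x y z : (y `|` z) * x = (y * x) `|` (z * x).
Proof. by rewrite !(mulgC _ x) crl_mulUr. Qed.

Lemma resid1 x : 1 ~> x = x.
Proof.
apply/le_anti/andP; split; last by rewrite -residP monoid.mul1g.
by rewrite -[leLHS]monoid.mul1g resid_mp.
Qed.

Lemma residM x y z : (x * y) ~> z = x ~> (y ~> z).
Proof.
apply/le_anti/andP; split; rewrite -!residP.
  by rewrite monoid.mulgA (mulgC y) resid_mp.
by rewrite (mulgC x) -monoid.mulgA residP resid_mp.
Qed.

Lemma negE x : \~ x = x ~> \~ 1.
Proof. by rewrite resid_neg resid1. Qed.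

Lemma neg_mul x y : \~ (x * \~ y) = x ~> y.
Proof. by rewrite negE residM -negE negK. Qed.

Lemma neg_resid x y : \~ (x ~> y) = x * \~ y.
Proof. by rewrite -neg_mul negK. Qed.

Lemma neg_le x y : x <= y -> \~ y <= \~ x.
Proof.
move=> xy; rewrite (negE x) -residP; apply: le_trans (resid_mp y _).
by rewrite -negE mulgC (mulgC y) le_mul2l.
Qed.

Lemma negI x y : \~ (x `&` y) = \~ x `|` \~ y.
Proof.
apply/le_anti/andP; split; last by rewrite leUx !neg_le ?leIl ?leIr.
rewrite -[leRHS]negK neg_le // lexI; apply/andP; split.
  by rewrite -[leRHS]negK neg_le ?leUl.
by rewrite -[leRHS]negK neg_le ?leUr.
Qed.

Lemma negU x y : \~ (x `|` y) = \~ x `&` \~ y.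
Proof. by rewrite -[RHS]negK negI !negK. Qed.

End CIRLTheory.

Definition nconucleus {d : Order.disp_t} {A : nelsonType d} (x : A) : A :=
  (x `&` 1) ^+ 2.

Section NelsonTheory.
Context {d : Order.disp_t} {A : nelsonType d}.
Implicit Types x y z : A.
Local Notation n := (@nconucleus d A).

Lemma nE x : n x = (x `&` 1) * (x `&` 1).
Proof. by []. Qed.

Lemma n_le1 x : n x <= 1.
Proof. by rewrite nE -[leRHS]monoid.mulg1 le_mul ?leIr. Qed.

Lemma n_le x : n x <= x.
Proof. by rewrite nE -[leRHS]monoid.mulg1 le_mul ?leIr ?leIl. Qed.

Lemma n_homo x y : x <= y -> n x <= n y.
Proof. by move=> xy; rewrite !nE le_mul ?leI2. Qed.

Lemma nM x y : n (x * y) = n x * n y.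
Proof. exact: nelson_sqrM. Qed.

Lemma n_mulE x y : x * y = (n x * y) `|` (x * n y).
Proof. exact: nelson_mulE. Qed.

Lemma n_meet1 x : n (x `&` 1) = n x.
Proof. by rewrite /nconucleus -meetA meetxx. Qed.

Lemma n_idem x : n x * n x = n x.
Proof.
set u := x `&` 1.
have e3 : u * (u * u) = u * u.
  rewrite [RHS]n_mulE n_meet1 nE -/u (mulgC (u * u) u); by rewrite joinxx.
by rewrite nE -/u -monoid.mulgA e3 e3.
Qed.

Lemma nn x : n (n x) = n x.
Proof. by rewrite {1}(nE x) nM n_meet1 n_idem. Qed.

Lemma n1 : n 1 = 1.
Proof. by rewrite nE meetxx monoid.mulg1. Qed.

Lemma nU x y : n (x `|` y) = n x `|` n y.
Proof.
apply/le_anti/andP; split; last by rewrite leUx !n_homo ?leUl ?leUr.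
rewrite nE meetUl !crl_mulUr !crl_mulUl !leUx -!nE leUl leUr /=.
rewrite (mulgC (y `&` 1)) andbT andbb n_mulE !n_meet1 leUx; apply/andP; split.
  apply: le_trans (leUl _ _).
  by rewrite -[leRHS]monoid.mulg1 le_mul2l ?leIr.
apply: le_trans (leUr _ _).
by rewrite mulgC -[leRHS]monoid.mulg1 le_mul2l ?leIr.
Qed.

Lemma n_mul_lel x y : n x * n y <= n x.
Proof. by rewrite -[leRHS]monoid.mulg1 le_mul2l ?n_le1. Qed.

Lemma n_mul_ler x y : n x * n y <= n y.
Proof. by rewrite mulgC n_mul_lel. Qed.

Lemma n_le_mul x y z : n x <= y -> n x <= z -> n x <= y * z.
Proof. by move=> xy xz; rewrite -n_idem le_mul. Qed.

Lemma nI x y : n (x `&` y) = n x * n y.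
Proof.
apply/le_anti/andP; split; first by rewrite n_le_mul ?n_homo ?leIl ?leIr.
rewrite -nM -nn n_homo // lexI nM.
by rewrite (le_trans (n_mul_lel _ _)) ?n_le // (le_trans (n_mul_ler _ _)) ?n_le.
Qed.

End NelsonTheory.

(* The order and the join are those of A, but the meet of two elements is
   nconucleus (x `&` y), in general smaller than their meet in A. *)
Definition HA (d : Order.disp_t) (A : nelsonType d) : Type :=
  set_type (range (@nconucleus d A)).

Section HAlgebra.
Context {d : Order.disp_t} {A : nelsonType d}.
Local Notation n := (@nconucleus d A).
Local Notation H := (HA A).
Implicit Types a b c : H.

HB.instance Definition _ := SubChoice.copy H (set_type (range n)).

Definition toHA (x : A) : H :=
  exist (fun y => y \in range n) (n x) (mem_set (imageT n x)).

Lemma val_toHA (x : A) : val (toHA x) = n x. Proof. by []. Qed.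

Lemma nHA a : n (val a) = val a.
Proof. by case: (set_mem (valP a)) => x _ <-; rewrite nn. Qed.

HB.instance Definition _ :=
  Order.SubChoice_isSubPOrder.Build d A (fun x => x \in range n) d H.

Lemma leHA a b : (a <= b) = (val a <= val b). Proof. by []. Qed.

Fact HA_join_range a b : val a `|` val b \in range n.
Proof. by apply/mem_set; exists (val a `|` val b) => //; rewrite nU !nHA. Qed.

Definition HA_join a b : H :=
  exist (fun y => y \in range n) (val a `|` val b) (HA_join_range a b).

Definition HA_meet a b : H := toHA (val a `&` val b).

Definition HA_imp a b : H := toHA (val a ~> val b).

Fact HA_meetP a b c : (a <= HA_meet b c) = (a <= b) && (a <= c).
Proof.
rewrite !leHA -lexI; apply/idP/idP => [h|/n_homo]; last by rewrite nHA.
exact: le_trans (n_le _).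
Qed.

Fact HA_joinP a b c : (HA_join a b <= c) = (a <= c) && (b <= c).
Proof. by rewrite !leHA leUx. Qed.

HB.instance Definition _ :=
  Order.POrder_MeetJoin_isLattice.Build d H HA_meetP HA_joinP.

Definition HA_top : H :=
  exist (fun y => y \in range n) 1 (mem_set (ex_intro2 _ _ 1 I n1)).

Fact HA_lex1 a : a <= HA_top.
Proof. by rewrite leHA -nHA n_le1. Qed.

HB.instance Definition _ := Order.hasTop.Build d H HA_lex1.

Lemma val_HA_meet a b : val (a `&` b) = val a * val b.
Proof. by rewrite [LHS]nI !nHA. Qed.

Lemma val_HA_join a b : val (a `|` b) = val a `|` val b.
Proof. by []. Qed.

Fact HA_impP a b c : (a `&` b <= c) = (b <= HA_imp a c).
Proof.
rewrite !leHA val_HA_meet residP; apply/idP/idP => [/n_homo|h].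
  by rewrite nHA.
exact: le_trans h (n_le _).
Qed.

HB.instance Definition _ := isBrouwerian.Build d H HA_impP.

Lemma val_HA_meetn a b : val (a `&` b) = n (val a `&` val b).
Proof. by []. Qed.

Lemma val_HA_imp a b : val (a =>> b) = n (val a ~> val b).
Proof. by []. Qed.

Lemma val_HA_top : val (\top : H) = 1.
Proof. by []. Qed.

Definition FA_set : set H := range (fun x : A => toHA (x `|` \~ x)).

Lemma FA_up (x : A) a : n x `|` n (\~ x) <= val a -> FA_set a.
Proof.
rewrite leUx => /andP[xa nxa]; exists (x `|` \~ x `|` val a) => //.
apply: val_inj; rewrite val_toHA !negU negK !nU !nI nHA.
have -> : n x `|` n (\~ x) `|` val a = val a.
  by apply/join_idPr; rewrite leUx xa nxa.
apply/join_idPl; apply: le_trans nxa.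
by rewrite -!nI n_homo // (le_trans (leIl _ _)) ?leIl.
Qed.

Fact FA_boolean : boolean_filter FA_set.
Proof.
split.
- by exists (toHA (1 `|` \~ 1)); exists 1.
- move=> _ b [x _ <-] h; apply: (@FA_up x).
  by rewrite -nU.
- move=> _ _ [x _ <-] [y _ <-].
  set s := x `|` \~ x; set t := y `|` \~ y.
  have hs : n (\~ s) <= n s.
    by rewrite n_homo // /s negU negK (le_trans (leIr _ _)) ?leUl.
  have ht : n (\~ t) <= n t.
    by rewrite n_homo // /t negU negK (le_trans (leIr _ _)) ?leUl.
  clearbody s t.
  apply: (@FA_up ((s `&` (n s ~> t)) `|` (t `&` (n t ~> s)))).
  have key u v : n u * n (n u ~> v) <= n u * n v.
    rewrite -nM n_le_mul // nM ?n_mul_lel // -nM -nn n_homo // nM.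
    by apply: le_trans (resid_mp (n u) v); rewrite le_mul2l ?n_le.
  rewrite val_HA_meet !val_toHA leUx; apply/andP; split.
    by rewrite nU leUx !nI !key [n s * n t]mulgC key.
  rewrite negU !negI !neg_resid nI !nU (nM (n s)) (nM (n t)) !nn; apply: le_mul.
    by rewrite leUx hs n_mul_lel.
  by rewrite leUx ht n_mul_lel.
- move=> a b; apply: (@FA_up (val a ~> val b)); rewrite val_HA_join joinC.
  by rewrite leU2 // neg_resid nM nHA -[leRHS]monoid.mulg1 le_mul2l ?n_le1.
Qed.

Definition FA : booleanFilter H := BooleanFilter FA_boolean.

End HAlgebra.

Arguments FA {d} A.

(* Main.v *)
Require Import Defs.
From HB Require Import structures.
From mathcomp Require Import all_boot all_order.
From mathcomp Require Import boolp classical_sets.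

Import Order.TTheory.

Local Open Scope group_scope.
Local Open Scope order_scope.
Local Open Scope residuated_scope.

(** The isomorphism is [x |-> (n x, n (~ x))].  The Nelson identity for [x * y]
    makes [n (x -> y)] a function of the two coordinates of [x] and [y]; as
    [x <= y] iff [n (x -> y) = 1], the map reflects the order and is injective.
    If [a b <= n (~ 1)] and [a \/ b = n (s)] with [s = c \/ ~ c], the pair
    [(a, b)] is the image of [(s /\ (b -> a)) \/ ~ (a -> b)]. *)

Section NelsonCoordinates.
Context {d : Order.disp_t} {A : nelsonType d}.
Implicit Types x y a b s : A.
Local Notation n := (@nconucleus d A).

Lemma mul_le_l x y : y <= 1 -> x * y <= x.
Proof. by move=> y1; rewrite -[leRHS]monoid.mulg1 le_mul2l. Qed.

(** [n x * n (n x ~> y)] is a fixed point of [n] below [y], hence below [n y]. *)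
Lemma n_resid_n x y : n (n x ~> n y) = n (n x ~> y).
Proof.
apply/le_anti/andP; split.
  by rewrite n_homo // -residP (le_trans (resid_mp _ _)) ?n_le.
rewrite -[leLHS]nn n_homo // -residP -[n x in leLHS]nn -nM -nn n_homo // nM nn.
by apply: le_trans (resid_mp (n x) y); rewrite le_mul2l ?n_le.
Qed.

(** Negation turns the join in the Nelson identity into the meet of [n x ~> \~ y] and [n y ~> \~ x],
    which [n] sends to a product. *)
Lemma n_neg_mul x y :
  n (\~ (x * y)) = n (n x ~> n (\~ y)) * n (n y ~> n (\~ x)).
Proof.
rewrite !n_resid_n -nI; congr n.
by rewrite n_mulE negU (mulgC x) -!neg_mul !negK.
Qed.

Lemma n_resid x y :
  n (x ~> y) = n (n x ~> n y) * n (n (\~ y) ~> n (\~ x)).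
Proof. by rewrite -neg_mul n_neg_mul negK. Qed.

Lemma n_eq1_ge1 x : n x = 1 -> 1 <= x.
Proof. by move=> <-; exact: n_le. Qed.

Lemma n_resid_eq1 x y : x <= y -> n (x ~> y) = 1.
Proof.
move=> xy; have xy1 : 1 <= x ~> y by rewrite -residP monoid.mulg1.
by rewrite nE (meet_idPr xy1) monoid.mulg1.
Qed.

(** Both factors of [n (x ~> y)] in [n_resid] equal [1], so [1 <= x ~> y]. *)
Lemma n_pair_le x y : n x <= n y -> n (\~ y) <= n (\~ x) -> x <= y.
Proof.
move=> le1 le2; rewrite -[x]monoid.mulg1 residP; apply: n_eq1_ge1.
by rewrite n_resid (n_resid_eq1 _ _ le1) (n_resid_eq1 _ _ le2) monoid.mulg1.
Qed.

Lemma n_pair_inj x y : n x = n y -> n (\~ x) = n (\~ y) -> x = y.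
Proof. by move=> e1 e2; apply/le_anti/andP; split; apply: n_pair_le; rewrite ?e1 ?e2. Qed.

Lemma n_mul_neg_le x : n x * n (\~ x) <= n (\~ 1).
Proof. by rewrite -nM n_homo // residP -negE. Qed.

(** Serves as the upper bound for both coordinates of [untwist]: the [a] part is modus ponens, the
    [b] part uses [n (a ~> b) <= 1]. *)
Lemma join_mul_n_resid_le a b : a <= 1 -> b <= 1 -> (a `|` b) * n (a ~> b) <= b.
Proof.
move=> a1 b1; rewrite crl_mulUl leUx mul_le_l ?n_le1 // andbT.
by apply: le_trans (resid_mp a b); rewrite le_mul2l ?n_le.
Qed.

Definition untwist s a b : A := (s `&` (b ~> a)) `|` \~ (a ~> b).

Lemma neg_untwist s a b :
  \~ untwist s a b = (\~ s `|` b * \~ a) `&` (a ~> b).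
Proof. by rewrite /untwist negU negK negI neg_resid. Qed.

(** The bound says [a <= \~ b]; as [n] fixes [a], also [a <= n (\~ b)], and [a] is idempotent. *)
Lemma mul_n_neg a b : n a = a -> n b = b -> a * b <= \~ 1 -> a * n (\~ b) = a.
Proof.
move=> na nb ab; apply/le_anti; rewrite mul_le_l ?n_le1 //=.
rewrite -{1}na n_le_mul // ?na // -na n_homo //.
by rewrite (negE b) -residP mulgC.
Qed.

(** The joinand [\~ (a ~> b)] is [a * \~ b] and contributes exactly [a]; the other contributes
    [(a \/ b) * n (b ~> a)], which is below [a]. *)
Lemma n_untwist s a b : n a = a -> n b = b -> a * b <= \~ 1 ->
  n s = a `|` b -> n (untwist s a b) = a.
Proof.
move=> na nb ab ns; have [a1 b1] : a <= 1 /\ b <= 1 by rewrite -na -nb !n_le1.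
rewrite /untwist neg_resid nU nI nM na mul_n_neg // ns.
by apply/join_idPr; rewrite joinC join_mul_n_resid_le.
Qed.

(** The left side reduces to [(n (\~ s) \/ b) * n (a ~> b)], where [n (\~ s) <= n s] keeps the first
    factor below [a \/ b]. *)
Lemma n_neg_untwist s a b : n a = a -> n b = b -> a * b <= \~ 1 ->
  n s = a `|` b -> n (\~ s) <= n s -> n (\~ untwist s a b) = b.
Proof.
move=> na nb ab ns les; have [a1 b1] : a <= 1 /\ b <= 1 by rewrite -na -nb !n_le1.
rewrite neg_untwist nI nU nM nb mul_n_neg //; last by rewrite mulgC.
apply/le_anti/andP; split.
  apply: le_trans (join_mul_n_resid_le _ _ a1 b1).
  by rewrite le_mul // leUx -{1}ns les leUr.
(* Since [b] is idempotent, it is enough to bound it by each factor; [b <= a ~> b] follows from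
   [a <= 1]. *)
rewrite -{1}nb n_le_mul // nb ?leUr // -{1}nb n_homo // -residP mulgC.
exact: mul_le_l.
Qed.

End NelsonCoordinates.

Section Representation.
Context {d : Order.disp_t} {A : nelsonType d}.
Local Notation n := (@nconucleus d A).
Local Notation T := (Tw (toHA (\~ (1 : A))) (FA A)).

Fact twist_le (x : A) : toHA x `&` toHA (\~ x) <= toHA (\~ 1).
Proof. by rewrite leHA val_HA_meet !val_toHA n_mul_neg_le. Qed.

Fact twist_mem (x : A) : bf_set (FA A) (toHA x `|` toHA (\~ x)).
Proof. by exists x => //; apply: val_inj; rewrite val_HA_join !val_toHA nU. Qed.

Definition twist (x : A) : T :=
  mkTw (p := (toHA x, toHA (\~ x))) (twist_le x) (twist_mem x).

Lemma twist_inj : injective twist.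
Proof.
move=> x y /(congr1 val) [e1 e2].
exact: n_pair_inj.
Qed.

Lemma twist_surj (t : T) : exists x, twist x = t.
Proof.
(* Membership in [FA] supplies [c] such that the join of the coordinates is [n (c \/ \~ c)]. *)
have := tw_le t; have [c _ /(congr1 val)] := tw_mem t.
case E : (val t) => [a b] /=.
rewrite leHA val_HA_meet val_toHA; set s := c `|` \~ c => ns ab.
have les : n (\~ s) <= n s.
  by rewrite n_homo // /s negU negK (le_trans (leIr _ _)) ?leUl.
have ab1 := le_trans ab (n_le _).
exists (untwist s (val a) (val b)); apply: twP; rewrite E; apply: val_inj.
  by rewrite /= n_untwist ?nHA.
by rewrite /= n_neg_untwist ?nHA.
Qed.

(** Choice turns surjectivity into a right inverse, which injectivity makes two-sided. *)
Lemma twist_bij : bijective twist.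
Proof.
have [g gK] := boolp.choice twist_surj.
by exists g => [x|t]; [apply: twist_inj; rewrite gK | rewrite gK].
Qed.

Lemma twist_neg : {morph twist : x / \~ x}.
Proof. by move=> x; apply: twP; rewrite //= negK. Qed.

Lemma twistI : {morph twist : x y / x `&` y}.
Proof.
move=> x y; apply: twP; apply: val_inj; rewrite val_twI /=.
  by rewrite !nI !nn.
by rewrite negI nU.
Qed.

Lemma twistM : {morph twist : x y / x * y}.
Proof.
move=> x y; apply: twP; apply: val_inj; rewrite val_twM /= nI !nn.
  exact: nM.
exact: n_neg_mul.
Qed.

(** By De Morgan, joins reduce to meets and negation. *)
Lemma twistU : {morph twist : x y / x `|` y}.
Proof.
move=> x y; rewrite -[x `|` y]negK negU twist_neg twistI negI.
by rewrite -!twist_neg !negK.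
Qed.

(** In both algebras [x ~> y] is [\~ (x * \~ y)]. *)
Lemma twist_resid : {morph twist : x y / x ~> y}.
Proof. by move=> x y; rewrite -neg_mul twist_neg twistM twist_neg neg_mul. Qed.

Lemma twist1 : twist 1 = 1.
Proof. by apply: twP; apply: val_inj; rewrite //= n1. Qed.

End Representation.

Theorem theorem35 (d : Order.disp_t) (A : nelsonType d) :
  cirl_isomorphic A (Tw (toHA (\~ (1 : A))) (FA A)).
Proof.
exists twist; split; first exact: twist_bij.
split; [exact: twistI | exact: twistU | exact: twistM | exact: twist_resid |].
by split; [exact: twist_neg | exact: twist1].
Qed.
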